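(* The EKG sequence satisfies $a(n)\le 14n$ for all integers $n\ge 1$.
   Context: The EKG sequence $(a(n))_{n\ge 1}$ is the sequence of positive integers defined by $a(1)=1$, $a(2)=2$ and, for $n\ge 3$, $a(n)$ is the smallest positive integer not in $\{a(k): 1\le k\le n-1\}$ such that $\gcd(a(n-1),a(n))\ge 2$. *)

(* Defs.v *)
From mathcomp Require Import all_boot zify.

Set Implicit Arguments.
Unset Strict Implicit.
Unset Printing Implicit Defensive.

(* Sequences are indexed from 1: the value [a 0] is never used. *)

Definition ekg_candidate (a : nat -> nat) (n m : nat) : Prop :=
  [/\ 0 < m, forall k, 1 <= k <= n - 1 -> a k <> m & 2 <= gcdn (a (n - 1)) m].

Definition is_ekg (a : nat -> nat) : Prop :=
  [/\ a 1 = 1, a 2 = 2 &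
      forall n, 3 <= n ->
        ekg_candidate a n (a n) /\
        forall m, ekg_candidate a n m -> a n <= m].

(* [is_ekg] determines the sequence: uniqueness on positive indices and
   existence. *)

Lemma ekg_unique (a b : nat -> nat) :
  is_ekg a -> is_ekg b -> forall n, 1 <= n -> a n = b n.
Proof.
move=> [a1 a2 Ha] [b1 b2 Hb].
elim/ltn_ind=> -[|[|[|n]]] IH // _; rewrite ?a1 ?a2 ?b1 ?b2 //.
have eqab k : 1 <= k <= n.+3 - 1 -> a k = b k by move=> hk; apply: IH; lia.
have cE m : ekg_candidate a n.+3 m <-> ekg_candidate b n.+3 m.
  rewrite /ekg_candidate eqab; last by lia.
  by split=> -[m0 mN mg]; split=> // k hk; [rewrite -eqab|rewrite eqab] => //;
     apply: mN.
have [ca ma] := Ha n.+3 isT; have [cb mb] := Hb n.+3 isT.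
by apply/eqP; rewrite eqn_leq ma ?mb //; apply/cE.
Qed.

(* [s] lists the terms already chosen, most recent first. *)
Definition ekg_ok (s : seq nat) (m : nat) : bool :=
  [&& 0 < m, m \notin s & 2 <= gcdn (head 0 s) m].

Definition ekg_next (s : seq nat) : nat :=
  find (ekg_ok s) (iota 0 (head 0 s * (sumn s).+1).+1).

Fixpoint ekg_prefix (n : nat) : seq nat :=
  if n is n'.+1 then ekg_next (ekg_prefix n') :: ekg_prefix n' else [:: 2; 1].

Definition ekg (n : nat) : nat :=
  if n is n'.+2 then head 0 (ekg_prefix n') else n.

Lemma ekg_nextP (s : seq nat) : 2 <= head 0 s ->
  ekg_ok s (ekg_next s) /\ forall m, ekg_ok s m -> ekg_next s <= m.
Proof.
move=> h2; set N := (head 0 s * (sumn s).+1).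
have mem_le x : x \in s -> x <= sumn s.
  elim: s {h2 N} => //= y s IH; rewrite inE => /orP[/eqP->|/IH]; lia.
have okN : ekg_ok s N.
  rewrite /ekg_ok gcdnMr h2 andbT; apply/andP; split; first by rewrite /N; nia.
  by apply/negP => /mem_le; rewrite /N; nia.
have hasN : has (ekg_ok s) (iota 0 N.+1).
  by apply/hasP; exists N => //; rewrite mem_iota; lia.
have fN : ekg_next s < N.+1 by move: hasN; rewrite has_find size_iota.
split; first by have := nth_find 0 hasN; rewrite nth_iota.
move=> m okm; rewrite leqNgt; apply/negP => ltm.
have := before_find 0 ltm; rewrite nth_iota ?okm //; lia.
Qed.

Lemma ekg_prefix_head n : 2 <= head 0 (ekg_prefix n).
Proof.
elim: n => //= n IH; have [/and3P[p0 _ p2] _] := ekg_nextP IH.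
have := dvdn_leq p0 (dvdn_gcdr (head 0 (ekg_prefix n)) _); lia.
Qed.

Lemma mem_ekg_prefix n m :
  m \in ekg_prefix n <-> exists2 k, 1 <= k <= n.+2 & ekg k = m.
Proof.
elim: n => [|n IH].
  rewrite !inE; split=> [/orP[]/eqP->|[[|[|[|k]]] //= _ <-]] //.
  - by exists 2.
  - by exists 1.
rewrite [ekg_prefix _]/= inE; split.
  case/orP=> [/eqP->|/IH[k hk <-]]; first by exists n.+3 => //; lia.
  by exists k => //; lia.
case=> k hk ekm; apply/orP; case: (eqVneq k n.+3) => [kE|kN].
  by left; rewrite -ekm kE.
by right; apply/IH; exists k => //; lia.
Qed.

Lemma ekg_exists : is_ekg ekg.
Proof.
split=> // -[|[|[|n]]] // _.
have cE m : ekg_candidate ekg n.+3 m <-> ekg_ok (ekg_prefix n) m.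
  rewrite /ekg_candidate subn1; split=> [[m0 mN mg]|/and3P[m0 /negP mN mg]].
    apply/and3P; split=> //; apply/negP => /mem_ekg_prefix[k hk ekm].
    by apply: (mN k).
  by split=> // k hk ekm; apply: mN; apply/mem_ekg_prefix; exists k.
have [ok le] := ekg_nextP (ekg_prefix_head n).
by split=> [|m /cE]; [apply/cE | apply: le].
Qed.

(* Main.v *)
Require Import Defs.
From mathcomp Require Import all_boot.
From mathcomp Require Import all_order all_algebra.
From mathcomp Require Import zify lra.

Set Implicit Arguments.
Unset Strict Implicit.
Unset Printing Implicit Defensive.

(** Let [m] be the first index with [X = a m > 14 m], let [p] be a prime dividing
    [a (m-1)] and [X], and put [X = k p]. If a prime [q] divides [a (i-1)], every
    multiple of [q] below [a i] occurs before [i]; hence [a i <= q i], and [k <= m].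
    Each [j p] with [5k/14 <= j <= k] is a term [a i > 5m] with [i <= m], so
    [a (i-1)] is coprime to 30. Either [a (i-1) = h p] with [h < k] coprime to 30,
    which happens for about [4k/15] values of [j] at most, or [a (i-1)] and [j p]
    share a prime [r >= 7] dividing [j] all of whose multiples up to [5m] occur
    before [m]. Let [R] be the set of these primes [r]. As
    [9/14 - 4/15 > 1/3], at least [k/3] numbers up to [k] have a factor in [R]
    (for [k < 24] a direct count is already contradictory), so the reciprocals
    of [R] sum to at least [1/3]. By Bonferroni's inequality, [R] then has at
    least [m] multiples up to [5m], but only [m - 1] terms precede [a m]. *)

(** * Counting multiples and integers coprime to 30 *)

Lemma count_dvdn (d n : nat) : 0 < d -> count (dvdn d) (iota 1 n) = n %/ d.
Proof.
move=> d0; elim: n => [|n IH]; first by rewrite div0n.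
rewrite -(addn1 n) iotaD count_cat IH /= addn0 add1n.
by rewrite addn1 divnS // addnC.
Qed.

(** The count has period 30, with 8 residues per period; the slack 14 is attained at [n = 19]. *)
Lemma count_coprime30 (n : nat) : 15 * count (coprime 30) (iota 1 n) <= 4 * n + 14.
Proof.
elim/ltn_ind: n => n IH; case: (ltnP n 30) => [n30|n30].
  have : all (fun n => 15 * count (coprime 30) (iota 1 n) <= 4 * n + 14) (iota 0 30).
    by vm_compute.
  by move/allP; apply; rewrite mem_iota.
have -> : n = 30 + (n - 30) by lia.
rewrite iotaD count_cat (addnC 1 30) iotaDl count_map.
rewrite (@eq_count _ (preim _ _) (coprime 30)); last first.
  by move=> x; rewrite /= /coprime gcdnDl.
rewrite mulnDr (_ : count _ (iota 1 30) = 8); last by vm_compute.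
by have := IH (n - 30); lia.
Qed.

Lemma count_has (T U : Type) (P : U -> pred T) (us : seq U) (s : seq T) :
  count (fun x => has (P^~ x) us) s <= \sum_(u <- us) count (P u) s.
Proof.
elim: us => [|u us IH]; first by rewrite big_nil (@eq_count _ _ pred0) ?count_pred0.
rewrite big_cons; apply: leq_trans (leq_add (leqnn _) IH).
by rewrite -count_predUI leq_addr.
Qed.

(** * Bonferroni's inequality, reciprocal sums and the resulting count *)

Section Bonferroni.

Import GRing.Theory Num.Theory Order.TTheory.
Local Open Scope ring_scope.

Definition recip_sum (s : seq nat) : rat := \sum_(r <- s) (r%:R)^-1.

Lemma divn_ge_rat (n d : nat) : (0 < d)%N ->
  (n%:R / d%:R - 1 : rat) <= (n %/ d)%N%:R.
Proof.
move=> d0; rewrite lerBlDr ler_pdivrMr ?ltr0n // natr1 -natrM ler_nat.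
by apply: ltnW; apply: ltn_ceil.
Qed.

Lemma divn_le_rat (n d : nat) : (n %/ d)%N%:R <= (n%:R / d%:R : rat).
Proof.
case: d => [|d]; first by rewrite divn0 invr0 mulr0.
by rewrite ler_pdivlMr ?ltr0n // -natrM ler_nat leq_trunc_div.
Qed.

Lemma sum_divn_le (n : nat) (s : seq nat) :
  (\sum_(r <- s) n %/ r)%N%:R <= n%:R * recip_sum s.
Proof.
by rewrite natr_sum /recip_sum mulr_sumr ler_sum // => r _; exact: divn_le_rat.
Qed.

(** Induction on [s]: a new prime [r] adds [n %/ r] multiples, less those shared with [s]. Each
    floor loses at most 1, whence the term [size s]. *)
Lemma count_multiples_ge (n : nat) (s : seq nat) : uniq s -> all prime s ->
  n%:R * (recip_sum s - recip_sum s ^+ 2 / 2%:R) - (size s)%:R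
    <= (count (fun N => has (dvdn^~ N) s) (iota 1 n))%:R :> rat.
Proof.
elim: s => [|r s IH] /=.
  by rewrite /recip_sum big_nil expr0n /= mul0r !subr0 mulr0 ler0n.
move=> /andP[rs us] /andP[pr ps]; have r0 := prime_gt0 pr.
have {IH} := IH us ps.
set P := (fun N => has (dvdn^~ N) s).
have E := count_predUI (dvdn r) P (iota 1 n).
rewrite count_dvdn // in E.
have {E} E : ((count (fun N => (r %| N)%N || P N) (iota 1 n))%:R : rat) =
   (n %/ r)%N%:R + (count P (iota 1 n))%:R
     - (count (predI (dvdn r) P) (iota 1 n))%:R.
  by rewrite -natrD -E natrD addrK.
(* Distinct primes [r] and [t] are coprime, so a common multiple is a multiple of [r * t]. *)
have I : (count (predI (dvdn r) P) (iota 1 n) <= \sum_(t <- s) (n %/ r) %/ t)%N.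
  apply: (@leq_trans (count (fun N => has (fun t => r * t %| N)%N s) (iota 1 n))).
    apply: sub_count => N /= /andP[rN /hasP[t ts tN]]; apply/hasP; exists t => //.
    rewrite Gauss_dvd ?rN // prime_coprime // dvdn_prime2 //; last exact: (allP ps).
    by apply: contraNneq rs => ->.
  apply: leq_trans (count_has _ _ _) _.
  rewrite big_seq [in leqRHS]big_seq; apply: leq_sum => t ts.
  by rewrite count_dvdn ?divnMA // muln_gt0 r0 prime_gt0 //; apply: (allP ps).
have {I} I : (count (predI (dvdn r) P) (iota 1 n))%:R <= n%:R / r%:R * recip_sum s.
  apply: le_trans (le_trans (sum_divn_le (n %/ r)%N s) _); first by rewrite ler_nat.
  by rewrite ler_wpM2r ?divn_le_rat // /recip_sum sumr_ge0 // => ? _; rewrite invr_ge0.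
have D := divn_ge_rat n r0.
rewrite E /recip_sum big_cons -/(recip_sum s) -[(size s).+1%:R]natr1.
(* Expanding [(x + c)^2 / 2] leaves the surplus [n * x^2 / 2], which is dropped. *)
have S : 0 <= n%:R * (r%:R^-1 : rat) ^+ 2.
  by rewrite mulr_ge0 ?sqr_ge0.
move: D I S; set x := (r%:R^-1 : rat); set c := recip_sum s. nra.
Qed.

(* The Bonferroni bound [5m (c - c^2/2) - m c] for a set of reciprocal sum [c]
   exceeds [m] for [c] in [1/3, 10/21]. *)
Lemma recip_sum_trim (s : seq nat) : all (leq 7) s -> 3%:R^-1 <= recip_sum s ->
  exists s', [/\ subseq s' s, 3%:R^-1 <= recip_sum s' & recip_sum s' <= 10%:R / 21%:R].
Proof.
elim: s => [_|r s IH /andP[r7 s7] le]; first by rewrite /recip_sum big_nil; lra.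
have [le'|lt'] := leP (recip_sum (r :: s)) (10%:R / 21%:R).
  by exists (r :: s); split=> //; exact: subseq_refl.
(* Removing [r] lowers the sum by at most 1/7, and 10/21 - 1/7 = 1/3. *)
have r7' : (r%:R^-1 : rat) <= 7%:R^-1 by rewrite lef_pV2 ?posrE ?ltr0n ?ler_nat //; lia.
have [||s' [ss l1 l2]] := IH => //.
  move: lt'; rewrite /recip_sum big_cons; lra.
by exists s'; split=> //; apply: subseq_trans ss (subseq_cons _ _).
Qed.

Lemma size_le_recip_sum (k : nat) (s : seq nat) :
  all (fun r => (0 < r <= k)%N) s -> (size s)%:R <= k%:R * recip_sum s.
Proof.
rewrite /recip_sum; elim: s => [|r s IH /= /andP[/andP[r0 rk] /IH]].
  by rewrite big_nil mulr0.
rewrite big_cons -add1n natrD mulrDr => H; apply: lerD => //.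
by rewrite ler_pdivlMr ?ltr0n // mul1r ler_nat.
Qed.

Lemma recip_sum_lt (k m : nat) (s : seq nat) : (0 < m)%N -> (k <= m)%N ->
  uniq s -> all prime s -> all (leq 7) s -> all (geq k) s ->
  (count (fun N => has (dvdn^~ N) s) (iota 1 (5 * m)) < m)%N ->
  recip_sum s < 3%:R^-1.
Proof.
move=> m0 km us ps s7 sk cnt; rewrite ltNge; apply/negP => ge3.
have [s' [/[dup] sub' /mem_subseq sub l1 l2]] := recip_sum_trim s7 ge3.
have sub_all P : all P s -> all P s'.
  by move=> /allP h; apply/allP => x /sub /h.
have := count_multiples_ge (5 * m) (subseq_uniq sub' us) (sub_all _ ps).
have sz : (size s')%:R <= m%:R * recip_sum s'.
  apply: size_le_recip_sum; apply/allP => r rs'.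
  have := allP (sub_all _ s7) _ rs'; have := allP (sub_all _ sk) _ rs'.
  by rewrite /=; lia.
have cnt' : ((count (fun N => has (dvdn^~ N) s') (iota 1 (5 * m)))%:R : rat) <= m%:R.
  rewrite ler_nat; apply: leq_trans (ltnW cnt); apply: sub_count => N /=.
  by case/hasP=> r /sub rs rN; apply/hasP; exists r.
have m0' : (0 : rat) < m%:R by rewrite ltr0n.
rewrite natrM; move: l1 l2 sz cnt' m0'.
set c := recip_sum s'; set M := (m%:R : rat).
move=> l1 l2 sz cnt' M0 B.
have : M * (5%:R * (c - c ^+ 2 / 2%:R) - c - 1) <= 0 by nra.
(* The quadratic [4c - 5c^2/2 - 1] is concave, equals 1/18 at 1/3 and is positive at 10/21. *)
rewrite pmulr_rle0 //; nra.
Qed.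

Lemma sum_divn_le_third (k m : nat) (s : seq nat) : (0 < m)%N -> (k <= m)%N ->
  uniq s -> all prime s -> all (leq 7) s -> all (geq k) s ->
  (count (fun N => has (dvdn^~ N) s) (iota 1 (5 * m)) < m)%N ->
  (3 * \sum_(r <- s) k %/ r <= k)%N.
Proof.
move=> m0 km us ps s7 sk cnt.
have lt := recip_sum_lt m0 km us ps s7 sk cnt.
have le := sum_divn_le k s.
rewrite -(ler_nat rat) natrM.
have k0 : 0 <= k%:R :> rat by rewrite ler0n.
nra.
Qed.

End Bonferroni.

(* In the application, the two terms on the left bound the number of terms
   [j * p] with [j] in [5k/14, k] whose predecessor is, respectively is not, a
   multiple of [p]. *)
Lemma counting_contradiction (k m : nat) (s : seq nat) : 0 < k <= m ->
  uniq s -> all prime s -> all (leq 7) s -> all (geq k) s ->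
  count (fun N => has (dvdn^~ N) s) (iota 1 (5 * m)) < m ->
  count (coprime 30) (iota 1 k.-1) + count (fun j => has (dvdn^~ j) s)
     [seq j <- iota 1 k | 5 * k <= 14 * j]
    < count (fun j => 5 * k <= 14 * j) (iota 1 k).
Proof.
move=> /andP[k0 km] us ps s7 sk cnt.
case: (ltnP k 24) => [k24|k24].
  (* Enlarging [s] to all primes at least 7 leaves a finite check in [k] alone. *)
  have : all (fun k => count (coprime 30) (iota 1 k.-1) +
      count (fun j => has (leq 7) (primes j)) [seq j <- iota 1 k | 5 * k <= 14 * j]
      < count (fun j => 5 * k <= 14 * j) (iota 1 k)) (iota 1 23) by vm_compute.
  move/allP/(_ k); rewrite mem_iota => /(_ ltac:(lia)).
  apply: leq_ltn_trans; rewrite leq_add2l.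
  rewrite !count_filter -!size_filter.
  apply: uniq_leq_size; first by rewrite filter_uniq ?iota_uniq.
  move=> j; rewrite !mem_filter /= mem_iota.
  move=> /andP[/andP[/hasP[r rs rj] ->] jk]; rewrite jk !andbT.
  apply/hasP; exists r; last exact: (allP s7).
  by rewrite mem_primes rj (allP ps) //; lia.
have m0 : 0 < m by lia.
have S := sum_divn_le_third m0 km us ps s7 sk cnt.
have C := count_coprime30 k.-1.
have E : count (fun j => has (dvdn^~ j) s) [seq j <- iota 1 k | 5 * k <= 14 * j]
    <= \sum_(r <- s) k %/ r.
  rewrite count_filter.
  apply: (@leq_trans (count (fun j => has (dvdn^~ j) s) (iota 1 k))).
    by apply: sub_count => j /andP[].
  apply: leq_trans (count_has _ _ _) _.
  rewrite big_seq [leqRHS]big_seq; apply: leq_sum => r rs.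
  by rewrite count_dvdn // prime_gt0 // (allP ps).
have L : 9 * k <= 14 * count (fun j => 5 * k <= 14 * j) (iota 1 k).
  (* [t] is the ceiling of [5k/14]. *)
  set t := (5 * k + 13) %/ 14.
  have tk : t <= k by rewrite /t; lia.
  suff : k.+1 - t <= count (fun j => 5 * k <= 14 * j) (iota 1 k) by rewrite /t; lia.
  rewrite -(size_iota t (k.+1 - t)) -size_filter.
  apply: uniq_leq_size; first exact: iota_uniq.
  by move=> j; rewrite mem_filter !mem_iota /t; lia.
(* The left side is at most [(4k + 10)/15 + k/3], short of [9k/14] by [3k/70 - 2/3], which is
   positive here. *)
lia.
Qed.

(** * Local properties of the EKG sequence *)

(** An unseen [N] would be a candidate at step [i], since [r] divides the gcd, contradicting the
    minimality of [a i]. *)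
Lemma ekg_seen_below (a : nat -> nat) (ha : is_ekg a) (i r N : nat) :
  3 <= i -> prime r -> r %| a i.-1 -> r %| N -> 0 < N < a i -> N \in map a (iota 1 i.-1).
Proof.
move=> i3 pr ra rN /andP[N0 Na]; apply/negPn/negP => nN.
have [_ _ /(_ i i3)[_ /(_ N)]] := ha; rewrite /ekg_candidate subn1 => mn.
suff : a i <= N by lia.
apply: mn; split=> //.
  move=> k hk ak; move/negP: nN; apply; apply/mapP; exists k => //.
  by rewrite mem_iota; lia.
have g0 : 0 < gcdn (a i.-1) N by rewrite gcdn_gt0 N0 orbT.
apply: leq_trans (prime_gt1 pr) _.
by apply: dvdn_leq => //; rewrite dvdn_gcd ra.
Qed.

Lemma ekg_gt0 (a : nat -> nat) (ha : is_ekg a) (i : nat) : 0 < i -> 0 < a i.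
Proof.
case: ha => a1 a2 H; case: i => [|[|[|i]]] // _; rewrite ?a1 ?a2 //.
by have [[]] := H i.+3 isT.
Qed.

Lemma ekg_inj (a : nat -> nat) (ha : is_ekg a) (i j : nat) :
  0 < i -> 0 < j -> a i = a j -> i = j.
Proof.
wlog ij : i j / i <= j.
  by move=> W i0 j0 e; case: (leqP i j) => h; [|apply/esym]; apply: W => //; lia.
move=> i0 j0 e; apply/eqP/negPn/negP => nij.
case: ha => a1 a2 H; case: (ltnP j 3) => j3.
  have [ei ej] : i = 1 /\ j = 2 by lia.
  by move: e; rewrite ei ej a1 a2.
have [[_ /(_ i) N _] _] := H j j3.
by apply: N e; lia.
Qed.

(** Otherwise [r, 2r, ..., ir] would be [i] distinct values among the [i - 1] earlier terms. *)
Lemma ekg_le_dvd (a : nat -> nat) (ha : is_ekg a) (i r : nat) :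
  3 <= i -> prime r -> r %| a i.-1 -> a i <= r * i.
Proof.
move=> i3 pr ra; rewrite leqNgt; apply/negP => lt; have r0 := prime_gt0 pr.
have : size (map (muln r) (iota 1 i)) <= size (map a (iota 1 i.-1)).
  apply: uniq_leq_size.
    by rewrite map_inj_uniq ?iota_uniq // => x y /eqP; rewrite eqn_pmul2l // => /eqP.
  move=> N /mapP[j]; rewrite mem_iota => hj ->.
  apply: (ekg_seen_below ha i3 pr ra); first exact: dvdn_mulr.
  by apply/andP; split; nia.
by rewrite !size_map !size_iota; lia.
Qed.

Lemma ekg_common_prime (a : nat -> nat) (ha : is_ekg a) (i : nat) : 3 <= i ->
  exists r, [/\ prime r, r %| a i.-1 & r %| a i].
Proof.
move=> i3; case: ha => _ _ /(_ i i3)[[_ _]]; rewrite subn1 => g2 _.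
exists (pdiv (gcdn (a i.-1) (a i))); split; first exact: pdiv_prime.
  exact: dvdn_trans (pdiv_dvd _) (dvdn_gcdl _ _).
exact: dvdn_trans (pdiv_dvd _) (dvdn_gcdr _ _).
Qed.

Lemma ekg_pred_coprime30 (a : nat -> nat) (ha : is_ekg a) (i : nat) :
  3 <= i -> 5 * i < a i -> coprime 30 (a i.-1).
Proof.
move=> i3 lt.
have N r : prime r -> r <= 5 -> coprime r (a i.-1).
  move=> pr r5; rewrite prime_coprime //; apply/negP => /(ekg_le_dvd ha i3 pr).
  by nia.
by rewrite -[30]/(2 * (3 * 5)) !coprimeMl !N.
Qed.

(** * The bound, by a minimal counterexample *)

Theorem theorem2 (a : nat -> nat) (ha : is_ekg a) (n : nat) (hn : 1 <= n) :
  a n <= 14 * n.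
Proof.
elim/ltn_ind: n hn => m IH m0; rewrite leqNgt; apply/negP => big.
have m3 : 3 <= m.
  have [a1 a2 _] := ha.
  have n1 : m != 1 by apply: contraTneq big => ->; rewrite a1.
  have n2 : m != 2 by apply: contraTneq big => ->; rewrite a2.
  by lia.
have record i : 0 < i < m -> a i < a m.
  by move=> /andP[i0 im]; have := IH i im i0; lia.
have [p [pp pu pX]] := ekg_common_prime ha m3.
have p0 := prime_gt0 pp.
pose k := a m %/ p.
have kE : k * p = a m by rewrite divnK.
have k0 : 0 < k by nia.
set seen := map a (iota 1 m.-1).
have multE j : 0 < j < k -> j * p \in seen.
  move=> jk; apply: (ekg_seen_below ha m3 pp pu); first exact: dvdn_mull.
  by nia.
have km : k <= m.
  have : size (map (muln^~ p) (iota 1 k.-1)) <= size seen.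
    apply: uniq_leq_size.
      by rewrite map_inj_uniq ?iota_uniq // => x y /eqP; rewrite eqn_pmul2r // => /eqP.
    by move=> N /mapP[j]; rewrite mem_iota => hj ->; apply: multE; lia.
  by rewrite !size_map !size_iota; lia.
(* The set [R], taken as all primes in [[7, k]] whose multiples up to [5m] have been seen. *)
pose s := [seq r <- iota 7 (k - 6) | prime r &&
             all (fun N => (r %| N) ==> (N \in seen)) (iota 1 (5 * m))].
have sP r : r \in s -> [/\ 7 <= r <= k, prime r &
    all (fun N => (r %| N) ==> (N \in seen)) (iota 1 (5 * m))].
  by rewrite mem_filter mem_iota => /andP[/andP[? ?] ?]; split=> //; lia.
have cnt : count (fun N => has (dvdn^~ N) s) (iota 1 (5 * m)) < m.
  have : count (fun N => has (dvdn^~ N) s) (iota 1 (5 * m)) <= size seen.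
    rewrite -size_filter; apply: uniq_leq_size; first by rewrite filter_uniq ?iota_uniq.
    move=> N; rewrite mem_filter => /andP[/hasP[r /sP[_ _ /allP h] rN] Nm].
    by have := h N Nm; rewrite rN.
  by rewrite size_map size_iota; lia.
pose I := [seq i <- iota 1 m | (p %| a i) && (5 * k <= 14 * (a i %/ p))].
have IP i : i \in I -> [/\ 3 <= i <= m, a i = a i %/ p * p,
    5 * k <= 14 * (a i %/ p), 0 < a i %/ p <= k & 5 * m < a i].
  rewrite mem_filter mem_iota => /andP[/andP[pa le] im].
  have aE : a i = a i %/ p * p by rewrite divnK.
  (* [14 * a i >= 5 * k * p = 5 * a m > 70 * m]. *)
  have lt5 : 5 * m < a i by rewrite aE; nia.
  have lea : a i <= a m by case: (eqVneq i m) => [->|ne] //; apply/ltnW/record; lia.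
  split=> //.
    have [a1 a2 _] := ha.
    have n1 : i != 1 by apply: contraTneq lt5 => ->; rewrite a1; lia.
    have n2 : i != 2 by apply: contraTneq lt5 => ->; rewrite a2; lia.
    by lia.
  by rewrite leq_div2r // divn_gt0 // dvdn_leq // (ekg_gt0 ha); lia.
have uI : uniq I by rewrite filter_uniq ?iota_uniq.
have quot_inj : {in I &, injective (fun i => a i %/ p)}.
  move=> i j /IP[i3 ei _ _ _] /IP[j3 ej _ _ _] /= e.
  by apply: (ekg_inj ha); [lia|lia|rewrite ei ej e].
have JI : count (fun j => 5 * k <= 14 * j) (iota 1 k) <= size I.
  rewrite -(size_map (fun i => a i %/ p) I) -size_filter.
  apply: uniq_leq_size; first by rewrite filter_uniq ?iota_uniq.
  move=> j; rewrite mem_filter mem_iota => /andP[le jk].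
  have [i im ai] : exists2 i, 1 <= i <= m & a i = j * p.
    case: (ltnP j k) => jk'.
      have /mapP[i] := multE j ltac:(lia); rewrite mem_iota => hi ->.
      by exists i => //; lia.
    by exists m; rewrite ?m0 ?leqnn // -kE; congr (_ * _); lia.
  apply/mapP; exists i; last by rewrite ai mulnK.
  by rewrite mem_filter mem_iota ai mulnK // dvdn_mull // le; lia.
(* Here [a i.-1 = h * p] with [h < k], as [a i.-1 < a m]; injectivity of [a] makes the [h]
   distinct. *)
have IQ : count (fun i => p %| a i.-1) I <= count (coprime 30) (iota 1 k.-1).
  rewrite -!size_filter.
  rewrite -(size_map (fun i => a i.-1 %/ p) [seq i <- I | _]).
  apply: uniq_leq_size.
    rewrite map_inj_in_uniq ?filter_uniq ?iota_uniq // => i j.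
    rewrite mem_filter => /andP[pi /IP[i3 _ _ _ _]].
    rewrite mem_filter => /andP[pj /IP[j3 _ _ _ _]] /= e.
    have : i.-1 = j.-1; last by lia.
    by apply: (ekg_inj ha); [lia|lia|rewrite -(divnK pi) -(divnK pj) e].
  move=> N /mapP[i]; rewrite mem_filter => /andP[pi /IP[i3 _ _ _ lt5]] ->.
  have co : coprime 30 (a i.-1) by apply: (ekg_pred_coprime30 ha); lia.
  have pos : 0 < a i.-1 by apply: (ekg_gt0 ha); lia.
  have lt := record i.-1 ltac:(lia).
  rewrite mem_filter mem_iota; apply/andP; split.
    by apply: coprime_dvdr co; apply: dvdn_div.
  by move: pos lt; rewrite -kE -{1 2}(divnK pi); nia.
have IN : count (predC (fun i => p %| a i.-1)) I <=
    count (fun j => has (dvdn^~ j) s) [seq j <- iota 1 k | 5 * k <= 14 * j].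
  rewrite -!size_filter.
  rewrite -(size_map (fun i => a i %/ p) [seq i <- I | _]).
  apply: uniq_leq_size.
    rewrite map_inj_in_uniq ?filter_uniq ?iota_uniq // => i j.
    rewrite mem_filter => /andP[_ iI]; rewrite mem_filter => /andP[_ jI].
    exact: quot_inj.
  move=> N /mapP[i]; rewrite mem_filter => /andP[npi /[dup] iI /IP[i3 aE le jk lt5]] ->.
  have [i3' _] := andP i3; have [r [pr ru rX]] := ekg_common_prime ha i3'.
  (* The case [r = p] is excluded because [p] does not divide [a i.-1]. *)
  have rj : r %| a i %/ p.
    move: rX; rewrite {1}aE Euclid_dvdM // => /orP[//|rp].
    have /eqP rp' : r == p by rewrite -dvdn_prime2.
    by move: npi; rewrite /= -rp' ru.
  (* [5m < a i <= r * i <= r * m] gives [r > 5], and 6 is not prime. *)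
  have r7 : 7 <= r.
    have := ekg_le_dvd ha i3' pr ru.
    have : r != 6 by apply: contraTneq pr => ->.
    by move: i3 lt5; clear; nia.
  have /andP[j0 jk'] := jk.
  have rk : r <= k by apply: leq_trans jk'; apply: dvdn_leq.
  rewrite !mem_filter mem_iota le; apply/andP; split; last by rewrite add1n ltnS.
  apply/hasP; exists r => //; rewrite mem_filter mem_iota pr /=.
  apply/andP; split; last by move: r7 rk; clear; lia.
  apply/allP => M; rewrite mem_iota => hM; apply/implyP => rM.
  have Mi : 0 < M < a i by move: hM lt5; clear; lia.
  have /mapP[l] := ekg_seen_below ha i3' pr ru rM Mi.
  rewrite mem_iota => hl ->; apply: map_f; rewrite mem_iota.
  by move: hl i3; clear; lia.
have : count (coprime 30) (iota 1 k.-1) + count (fun j => has (dvdn^~ j) s)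
     [seq j <- iota 1 k | 5 * k <= 14 * j]
    < count (fun j => 5 * k <= 14 * j) (iota 1 k).
  apply: (@counting_contradiction k m s _ _ _ _ _ cnt).
  - by rewrite k0.
  - by rewrite filter_uniq ?iota_uniq.
  - by apply/allP => r /sP[].
  - by apply/allP => r /sP[/andP[]].
  - by apply/allP => r /sP[/andP[]].
have := count_predC (fun i => p %| a i.-1) I.
lia.
Qed.
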